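(* Let $(\mathcal{N},\mathcal{I})$ be a $k$-system with rank $r$ on a ground set of size $n$, let $f:2^{\mathcal{N}}\to\mathbb{R}_{\ge0}$ be non-negative submodular, and run SimultaneousGreedys with $\ell=\lfloor 2+\sqrt{k+2}\rfloor$ solutions. Then the algorithm makes $O(krn)$ calls to the value and independence oracles and outputs an independent set whose approximation ratio is at most $(1+\sqrt{k+2})^2=k+O(\sqrt{k})$. Moreover, when $f$ is non-negative monotone submodular and $\ell=1$, the approximation ratio improves to $k+1$.
   Context: $\mathcal{N}$ is a finite ground set of size $n$. A set function $f$ is submodular if $f(X\cup Y)+f(X\cap Y)\le f(X)+f(Y)$ for all $X,Y\subseteq\mathcal{N}$, and monotone if $f(A)\le f(B)$ for $A\subseteq B$; write $f(u\mid S)=f(S\cup\{u\})-f(S)$ and $S+u=S\cup\{u\}$. An independence system $(\mathcal{N},\mathcal{I})$ is a non-empty family $\mathcal{I}\subseteq 2^{\mathcal{N}}$ closed under taking subsets. For $B\subseteq\mathcal{N}$, a base of $B$ is an inclusion-maximal independent subset of $B$. The system is a $k$-system if for every $B\subseteq\mathcal{N}$ the ratio between the sizes of any two bases of $B$ is at most $k$. The rank $r$ is the maximum size of an independent set. It is assumed that $\{u\}\in\mathcal{I}$ for every $u\in\mathcal{N}$. $OPT$ denotes a set in $\mathcal{I}$ maximizing $f$; an output $S\in\mathcal{I}$ has approximation ratio at most $\alpha$ if $f(S)\ge f(OPT)/\alpha$. The algorithm accesses $f$ only via a value oracle and $\mathcal{I}$ only via an independence oracle. SimultaneousGreedys$(\mathcal{N},f,\mathcal{I},\ell)$: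 initialize $S^{(j)}_0=\varnothing$ for $j=1,\dots,\ell$ and $\mathcal{N}_0=\mathcal{N}$. At iteration $i=1,2,\dots$, let $\mathcal{A}_i$ be the set of pairs $(u,j)$ with $u\in\mathcal{N}_{i-1}$, $j\in\{1,\dots,\ell\}$, $S^{(j)}_{i-1}+u\in\mathcal{I}$ and $f(u\mid S^{(j)}_{i-1})>0$. If $\mathcal{A}_i=\varnothing$, stop. Otherwise choose $(u_i,j_i)\in\mathcal{A}_i$ maximizing $f(u\mid S^{(j)}_{i-1})$, set $S^{(j_i)}_i=S^{(j_i)}_{i-1}+u_i$, $S^{(j)}_i=S^{(j)}_{i-1}$ for $j\ne j_i$, and $\mathcal{N}_i=\mathcal{N}_{i-1}-u_i$. On termination, output the set maximizing $f$ among the $\ell$ final solutions. *)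

(* Defs.v *)
From mathcomp Require Import all_boot all_order all_algebra.
From mathcomp Require Import reals.

Set Implicit Arguments.
Unset Strict Implicit.
Unset Printing Implicit Defensive.

Import Order.TTheory GRing.Theory Num.Theory.
Local Open Scope ring_scope.

Section SetFunctions.
Variables (R : realType) (T : finType).
Implicit Types (f : {set T} -> R) (I : {set {set T}}).

Definition nonnegative f := forall X, 0 <= f X.

Definition submodular f :=
  forall X Y, f (X :|: Y) + f (X :&: Y) <= f X + f Y.

Definition monotone f := forall A B : {set T}, A \subset B -> f A <= f B.

Definition independence_system I :=
  I != set0 /\ forall A B : {set T}, A \subset B -> B \in I -> A \in I.

Definition base I (B X : {set T}) : bool :=
  maxset (fun Y : {set T} => (Y \in I) && (Y \subset B)) X.

(* The ratio condition #|X| / #|Y| <= k is written without division, so that  *)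
(* sets B whose only base is empty satisfy it.                                *)
Definition k_system (k : R) I :=
  independence_system I /\
  forall B X Y : {set T}, base I B X -> base I B Y -> #|X|%:R <= k * #|Y|%:R.

Definition rank I : nat := (\max_(X in I) #|X|)%N.

Definition optimal f I (O : {set T}) :=
  O \in I /\ forall X, X \in I -> f X <= f O.

Definition approx_ratio_le f I (alpha : R) (S : {set T}) :=
  forall OPT, optimal f I OPT -> f OPT / alpha <= f S.

End SetFunctions.

(* Computations that access the set function and the independence system only *)
(* through queries. [Choose p q] continues as p or as q, arbitrarily; it is   *)
(* used to leave all tie-breaking unspecified.                                *)
Inductive oprog (T : finType) (R X : Type) : Type :=
| Ret of X
| AskValue of {set T} & (R -> oprog T R X)
| AskIndep of {set T} & (bool -> oprog T R X)
| Choose of oprog T R X & oprog T R X.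

Arguments Ret {T R X}.
Arguments AskValue {T R X}.
Arguments AskIndep {T R X}.
Arguments Choose {T R X}.

Fixpoint bind T R X Y (p : oprog T R X) (q : X -> oprog T R Y) : oprog T R Y :=
  match p with
  | Ret x => q x
  | AskValue B p' => AskValue B (fun v => bind (p' v) q)
  | AskIndep B p' => AskIndep B (fun b => bind (p' b) q)
  | Choose p1 p2 => Choose (bind p1 q) (bind p2 q)
  end.

(* [exec f I p x c]: some run of p, with queries answered according to f and  *)
(* I, returns x after exactly c oracle calls (value and independence calls    *)
(* together).                                                                 *)
Inductive exec (T : finType) R X (f : {set T} -> R) (I : {set {set T}}) :
    oprog T R X -> X -> nat -> Prop :=
| exec_ret x : exec f I (Ret x) x 0
| exec_value S p x c :
    exec f I (p (f S)) x c -> exec f I (AskValue S p) x c.+1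
| exec_indep S p x c :
    exec f I (p (S \in I)) x c -> exec f I (AskIndep S p) x c.+1
| exec_left p q x c : exec f I p x c -> exec f I (Choose p q) x c
| exec_right p q x c : exec f I q x c -> exec f I (Choose p q) x c.

Lemma exec_total (T : finType) R X (f : {set T} -> R) I (p : oprog T R X) :
  exists x c, exec f I p x c.
Proof.
elim: p => [x|S p IH|S p IH|p [x [c H]] q _].
- by exists x, 0%N; apply: exec_ret.
- by have [x [c H]] := IH (f S); exists x, c.+1; apply: exec_value.
- by have [x [c H]] := IH (S \in I); exists x, c.+1; apply: exec_indep.
- by exists x, c; apply: exec_left.
Qed.

Section SimultaneousGreedys.
Variables (T : finType) (R : realType) (l : nat).

(* An arbitrary element of y :: s. *)
Fixpoint pick_any X (y : X) (s : seq X) : oprog T R X :=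
  if s is z :: s' then Choose (Ret y) (pick_any z s') else Ret y.

Definition maximizers X (s : seq (X * R)) : seq X :=
  [seq p.1 | p <- s & all (fun q => q.2 <= p.2) s].

Definition ask_marginal (u : T) (S : {set T}) : oprog T R R :=
  AskValue (u |: S) (fun a => AskValue S (fun b => Ret (a - b))).

(* The pairs (u, j) of s that belong to A_i, each with its gain f(u | S_j). *)
Fixpoint admissible (S : 'I_l -> {set T}) (s : seq (T * 'I_l)) :
    oprog T R (seq (T * 'I_l * R)) :=
  if s is (u, j) :: s' then
    AskIndep (u |: S j) (fun indep =>
      if indep then
        bind (ask_marginal u (S j)) (fun g =>
        bind (admissible S s') (fun A =>
        Ret (if 0 < g then ((u, j), g) :: A else A)))
      else admissible S s')
  else Ret [::].

(* The number m bounds #|N|: when it reaches 0 no element is left, hence no   *)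
(* pair is admissible, and the loop stops as it should.                       *)
Fixpoint greedy_loop (m : nat) (N : {set T}) (S : 'I_l -> {set T}) :
    oprog T R ('I_l -> {set T}) :=
  if m is m'.+1 then
    bind (admissible S [seq (u, j) | u <- enum N, j <- enum 'I_l]) (fun A =>
    if maximizers A is y :: s then
      bind (pick_any y s) (fun uj =>
      greedy_loop m' (N :\ uj.1)
        (fun j => if j == uj.2 then uj.1 |: S j else S j))
    else Ret S)
  else Ret S.

Fixpoint ask_values (S : 'I_l -> {set T}) (s : seq 'I_l) :
    oprog T R (seq ('I_l * R)) :=
  if s is j :: s' then
    AskValue (S j) (fun v =>
    bind (ask_values S s') (fun V => Ret ((j, v) :: V)))
  else Ret [::].

(* The last branch is reached only for l = 0. *)
Definition simultaneous_greedys : oprog T R {set T} :=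
  bind (greedy_loop #|T| [set: T] (fun=> set0)) (fun S =>
  bind (ask_values S (enum 'I_l)) (fun V =>
  if maximizers V is j :: s then bind (pick_any j s) (fun j' => Ret (S j'))
  else Ret set0)).

End SimultaneousGreedys.

(* Main.v *)
Require Import Defs.
From mathcomp Require Import all_boot all_order all_algebra.
From mathcomp Require Import reals.
From mathcomp Require Import lra ring zify.

(** An element of an optimum O missing from a final solution A was either
    blocked by A while still available, or forfeited to another solution whose
    gain was at least as large, or has no positive marginal gain at A. In a
    k-system A blocks at most k |A| elements of O, and the same holds at all
    earlier times; as the greedy gains decrease, the blocked elements cost at
    most k (f(A) - f(0)). The forfeited ones cost at most the total gain of the
    other solutions. Hence f(O u A) <= (k + l) f(S) for the output S, which
    suffices when f is monotone and l = 1. In general the l solutions are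
    disjoint, so their values f(O u A) add up to at least (l - 1) f(O), and
    (l - 1) f(O) <= l (k + l) f(S).

    Every round adds one element to some solution and makes at most 3 n l calls,
    so there are at most (l r + 1) 3 n l + l calls, where l ^ 2 = O(k). *)

Set Implicit Arguments.
Unset Strict Implicit.
Unset Printing Implicit Defensive.

Import Order.TTheory GRing.Theory Num.Theory.
Local Open Scope ring_scope.

Section MarginalGains.
Variables (R : realType) (T : finType) (f : {set T} -> R).
Implicit Types (A B S : {set T}) (u v : T).

Definition marginal u S : R := f (u |: S) - f S.

Definition pos_marginal u S : R := Num.max 0 (marginal u S).

Lemma pos_marginal_ge0 u S : 0 <= pos_marginal u S.
Proof. by rewrite le_max lexx. Qed.

Lemma marginal_le_pos u S : marginal u S <= pos_marginal u S.
Proof. by rewrite le_max lexx orbT. Qed.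

Lemma pos_marginal_mem u S : u \in S -> pos_marginal u S = 0.
Proof.
move=> uS; rewrite /pos_marginal /marginal (setUidPr _) ?sub1set //.
by rewrite subrr maxxx.
Qed.

Hypothesis f_sub : submodular f.

Lemma marginal_antitone u A B : A \subset B -> u \notin B ->
  marginal u B <= marginal u A.
Proof.
move=> sAB uB; have := f_sub (u |: A) B.
have -> : (u |: A) :|: B = u |: B by rewrite -setUA (setUidPr sAB).
have -> : (u |: A) :&: B = A.
  by rewrite setIUl (setIidPl sAB) disjoint_setI0 ?set0U ?disjoints1.
by rewrite /marginal; lra.
Qed.

Lemma pos_marginal_antitone u A B : A \subset B ->
  pos_marginal u B <= pos_marginal u A.
Proof.
move=> sAB; have [uB|uB] := boolP (u \in B).
  by rewrite pos_marginal_mem ?pos_marginal_ge0.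
by rewrite ge_max pos_marginal_ge0 /= le_max marginal_antitone ?orbT.
Qed.

Lemma ler_sum_pos_marginal (X Y : {set T}) A B : X \subset Y -> A \subset B ->
  \sum_(u in X) pos_marginal u B <= \sum_(u in Y) pos_marginal u A.
Proof.
move=> sXY sAB; rewrite [leRHS](big_setID X) /= (setIidPr sXY).
apply: ler_wpDr; first by apply: sumr_ge0 => u _; apply: pos_marginal_ge0.
by apply: ler_sum => u _; apply: pos_marginal_antitone.
Qed.

Lemma setU_le_sum_pos_marginal A S :
  f (A :|: S) <= f S + \sum_(u in A) pos_marginal u S.
Proof.
rewrite -big_enum -[in leLHS](set_enum A); elim: (enum A) => [|u s IH] /=.
  by rewrite set_nil set0U big_nil addr0.
rewrite set_cons big_cons -setUA; move: [set:: s] IH => X.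
have := marginal_le_pos u (X :|: S); rewrite {1}/marginal.
by have := pos_marginal_antitone u (subsetUr X S); lra.
Qed.

(* The sets O :|: S j and O :|: \bigcup S i meet in O, so submodularity trades
   f (O :|: S j) for one f O and a larger union. *)
Lemma sum_disjoint_union_ge (J : finType) (S : J -> {set T}) (O : {set T})
    (s : seq J) : nonnegative f -> uniq s ->
  (forall i j, i != j -> [disjoint S i & S j]) ->
  ((size s)%:R - 1) * f O <= \sum_(j <- s) f (O :|: S j).
Proof.
move=> f_ge0 s_uniq disj.
suff: (size s)%:R * f O + f (O :|: \bigcup_(j <- s) S j) <=
      \sum_(j <- s) f (O :|: S j) + f O.
  by have := f_ge0 (O :|: \bigcup_(j <- s) S j); lra.
elim: s s_uniq => [|j s IH] /=; first by rewrite !big_nil setU0; lra.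
case/andP=> js /IH{}IH; rewrite !big_cons.
have := f_sub (O :|: S j) (O :|: \bigcup_(i <- s) S i).
rewrite -setUIr setUACA setUid.
have -> : S j :&: \bigcup_(i <- s) S i = set0.
  apply/disjoint_setI0; rewrite bigcup_seq.
  by apply: bigcup_disjoint => i /(memPn js) ij; apply: disj; rewrite eq_sym.
by rewrite setU0 -natr1; lra.
Qed.

End MarginalGains.

Section Blocking.
Variables (T : finType) (I : {set {set T}}).
Hypothesis indI : independence_system I.
Implicit Types (N A B : {set T}).

Definition blocked A : {set T} := [set v | v |: A \notin I].

Definition available N A : {set T} := N :\: blocked A.

Lemma availableE N A v : (v \in available N A) = (v |: A \in I) && (v \in N).
Proof. by rewrite !inE negbK. Qed.

Lemma indep_subset A B : A \subset B -> B \in I -> A \in I.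
Proof. by case: indI => _; apply. Qed.

Lemma indep0 : set0 \in I.
Proof.
by case: indI => /set0Pn[A AI] _; apply: indep_subset AI; apply: sub0set.
Qed.

Lemma blockedS A B : A \subset B -> blocked A \subset blocked B.
Proof.
move=> sAB; apply/subsetP => v; rewrite !inE.
by apply: contra; apply: indep_subset; apply: setUS.
Qed.

Lemma availableS N N' A B : N' \subset N -> A \subset B ->
  available N' B \subset available N A.
Proof. by move=> sN sAB; apply: setDSS (blockedS sAB). Qed.

Lemma base_setU_blocked A B : A \in I -> B \subset blocked A ->
  base I (A :|: B) A.
Proof.
move=> AI blkB; apply/maxsetP; split; first by rewrite AI subsetUl.
move=> Y /andP[YI sY] sAY; apply/eqP; rewrite eqEsubset sAY andbT.
apply/subsetP => v vY; move/subsetP/(_ v vY): sY; rewrite inE.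
case/orP=> // /(subsetP blkB); rewrite inE => /negP[].
by apply: indep_subset YI; rewrite subUset sub1set vY.
Qed.

Lemma indep_card_le_rank A : A \in I -> (#|A| <= rank I)%N.
Proof. exact: leq_bigmax_cond. Qed.

End Blocking.

Lemma k_system_card_blocked (R : realType) (T : finType) (I : {set {set T}})
    (k : R) (A B : {set T}) :
  k_system k I -> A \in I -> B \in I -> B \subset blocked I A ->
  #|B|%:R <= k * #|A|%:R.
Proof.
case=> indI ratio AI BI blkB.
have [X baseX sBX] := @maxset_exists _
  (fun Y : {set T} => (Y \in I) && (Y \subset A :|: B)) B
  (introT andP (conj BI (subsetUr A B))).
apply: le_trans (ratio _ _ _ baseX (base_setU_blocked indI AI blkB)).
by rewrite ler_nat subset_leq_card.
Qed.

Section GreedyRuns.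
Variables (R : realType) (T : finType) (f : {set T} -> R) (I : {set {set T}}).
Variable l : nat.
Implicit Types (N : {set T}) (S : 'I_l -> {set T}) (u v : T) (i j : 'I_l).

Definition add_to S u j : 'I_l -> {set T} :=
  fun i => if i == j then u |: S i else S i.

Lemma add_to_same S u j : add_to S u j j = u |: S j.
Proof. by rewrite /add_to eqxx. Qed.

Lemma add_to_other S u i j : i != j -> add_to S u j i = S i.
Proof. by rewrite /add_to => /negPf ->. Qed.

Lemma subset_add_to S u i j : S i \subset add_to S u j i.
Proof. by rewrite /add_to; case: eqP; rewrite ?subsetUr. Qed.

Lemma bigcup_add_to S u j :
  \bigcup_i add_to S u j i = u |: \bigcup_i S i.
Proof.
rewrite (bigD1 j) //= [in RHS](bigD1 j) //= add_to_same setUA.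
by congr (_ :|: _); apply: eq_bigr => i; apply: add_to_other.
Qed.

Definition greedy_choice N S u j :=
  [/\ u \in available I N (S j), 0 < marginal f u (S j) &
      forall v i, v \in available I N (S i) ->
        marginal f v (S i) <= marginal f u (S j)].

Definition exhausted N S :=
  forall v i, v \in available I N (S i) -> marginal f v (S i) <= 0.

Inductive greedy_run : {set T} -> ('I_l -> {set T}) -> Prop :=
| greedy_run_start : greedy_run setT (fun=> set0)
| greedy_run_step N S u j : greedy_run N S -> greedy_choice N S u j ->
    greedy_run (N :\ u) (add_to S u j).

Lemma greedy_choice_indep N S u j : greedy_choice N S u j -> u |: S j \in I.
Proof. by case; rewrite availableE => /andP[]. Qed.

Lemma greedy_choice_mem N S u j : greedy_choice N S u j -> u \in N.
Proof. by case; rewrite availableE => /andP[]. Qed.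

Lemma greedy_choice_pos_marginal N S u j v i : greedy_choice N S u j ->
  v \in available I N (S i) -> pos_marginal f v (S i) <= marginal f u (S j).
Proof. by case=> _ d_gt0 d_max /d_max le_d; rewrite ge_max ltW. Qed.

Lemma greedy_run_indep N S j : set0 \in I -> greedy_run N S -> S j \in I.
Proof.
move=> I0; elim=> // {}N {}S u i _ SI /greedy_choice_indep uI.
by rewrite /add_to; case: eqP => // ->.
Qed.

Lemma greedy_run_cover N S : greedy_run N S -> \bigcup_j S j = ~: N.
Proof.
elim=> [|{}N {}S u j _ cov _]; first by rewrite big1 ?setCT.
by rewrite bigcup_add_to cov setDE setCI setCK setUC.
Qed.

Lemma greedy_run_fresh N S u j : greedy_run N S -> u \in N -> u \notin S j.
Proof.
move=> /greedy_run_cover cov uN; apply/negP => uS.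
have /subsetP/(_ u uS) : S j \subset ~: N by rewrite -cov bigcup_sup.
by rewrite inE uN.
Qed.

Lemma greedy_run_disjoint N S i j :
  greedy_run N S -> i != j -> [disjoint S i & S j].
Proof.
move=> run; elim: run i j => [i j _|{}N {}S u h run dS].
  by rewrite disjoints_subset sub0set.
move=> /greedy_choice_mem uN i j ij.
have fresh i' : u \notin S i' := greedy_run_fresh i' run uN.
have disjU1 i' j' : i' != j' -> [disjoint u |: S i' & S j'].
  move=> ij'; rewrite disjoints_subset subUset sub1set inE fresh.
  by rewrite -disjoints_subset dS.
rewrite /add_to; case: eqP => [ih|_]; case: eqP => [jh|_]; last exact: dS.
- by rewrite ih jh eqxx in ij.
- exact: disjU1.
- by rewrite disjoint_sym disjU1 // eq_sym.
Qed.

Lemma greedy_run_card N S :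
  greedy_run N S -> (\sum_j #|S j| + #|N| = #|T|)%N.
Proof.
move=> run; rewrite -(cardsC N) addnC; congr (_ + _)%N.
rewrite -(greedy_run_cover run) -sum1_card partition_disjoint_bigcup //.
  by under [RHS]eq_bigr do rewrite sum1_card.
by move=> i j; apply: greedy_run_disjoint run.
Qed.

End GreedyRuns.

Section Charging.
Variables (R : realType) (T : finType) (I : {set {set T}}) (k : R).
Variables (f : {set T} -> R).
Hypotheses (kI : k_system k I) (f_sub : submodular f).
Implicit Types (N O A B : {set T}) (u v : T) (d g w : R).

Let indI : independence_system I := proj1 kI.

Definition newly_blocked O N A u : {set T} :=
  O :&: available I N A :&: blocked I (u |: A).

Definition forfeited O N A B : {set T} := O :\: (B :|: available I N A).

Lemma notin_forfeited O N A B u :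
  u \in available I N A -> u \notin forfeited O N A B.
Proof. by move=> uN; rewrite inE in_setU uN orbT. Qed.

Lemma forfeited_own O N A B u :
  forfeited O (N :\ u) (u |: A) (B :|: newly_blocked O N A u)
    \subset u |: forfeited O N A B.
Proof.
by apply/subsetP => v; rewrite !inE; do !case: (_ \in _); case: eqP.
Qed.

Lemma forfeited_other O N A B u :
  forfeited O (N :\ u) A B \subset u |: forfeited O N A B.
Proof.
by apply/subsetP => v; rewrite !inE; do !case: (_ \in _); case: eqP.
Qed.

(* B collects the elements of O that A blocked while they were still available;
   the forfeited elements outside A went to other solutions, whose gains w pay
   for them. The term (k #|A| - #|B|) g is an online Abel summation: g, the last
   gain, only decreases and k #|A| - #|B| is nonnegative, so k times each gain
   of A pays for the elements it blocks, now or later. *)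
Definition charged O N A g w := exists B,
  [/\ B \subset O :&: blocked I A,
      \sum_(v in B) pos_marginal f v A + (k * #|A|%:R - #|B|%:R) * g
        <= k * (f A - f set0)
    & \sum_(v in forfeited O N A B) pos_marginal f v A <= w].

Lemma charged_start O g :
  (forall u, [set u] \in I) -> charged O setT set0 g 0.
Proof.
move=> I1; exists set0; split; first exact: sub0set.
  by rewrite big_set0 cards0 mulr0 !subrr mul0r mulr0 addr0.
by rewrite big_pred0 // => v; rewrite !inE negbK setU0 I1.
Qed.

Lemma surplus_ge0 O A B : O \in I -> A \in I -> B \subset O :&: blocked I A ->
  0 <= k * #|A|%:R - #|B|%:R.
Proof.
move=> OI AI; rewrite subsetI subr_ge0 => /andP[sBO blkB].
exact: (k_system_card_blocked kI AI (indep_subset indI sBO OI) blkB).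
Qed.

Section Step.
Variables (O N A : {set T}) (u : T) (d g w : R).
Hypotheses (OI : O \in I) (AI : A \in I) (le_dg : d <= g).
Hypothesis le_d : {in available I N A, forall v, pos_marginal f v A <= d}.

Lemma sum_newly_blocked_le :
  \sum_(v in newly_blocked O N A u) pos_marginal f v A
    <= #|newly_blocked O N A u|%:R * d.
Proof.
rewrite mulr_natl -sumr_const; apply: ler_sum => v.
by case/setIP => /setIP[_ /le_d].
Qed.

Lemma charged_own : u \in available I N A -> marginal f u A = d ->
  u \notin A -> charged O N A g w -> charged O (N :\ u) (u |: A) d w.
Proof.
move=> u_avail def_d uA [B [sB le_own le_lost]].
have sA : A \subset u |: A := subsetUr _ _.
exists (B :|: newly_blocked O N A u); split.
- rewrite subUset (subset_trans sB) ?setIS ?blockedS //=.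
  by rewrite setSI ?subsetIl.
- have disjB : [disjoint B & newly_blocked O N A u].
    rewrite disjoints_subset (subset_trans sB) //; apply/subsetP => v.
    by rewrite !inE => /andP[_ ->]; rewrite andbF.
  have le_new := sum_newly_blocked_le.
  move: (newly_blocked O N A u) disjB le_new => B' disjB le_new.
  have le_blocked : \sum_(v in B :|: B') pos_marginal f v (u |: A) <=
      \sum_(v in B) pos_marginal f v A + #|B'|%:R * d.
    apply: le_trans (ler_sum_pos_marginal f_sub (subxx (B :|: B')) sA) _.
    under eq_bigl => v do rewrite inE.
    by rewrite bigU // lerD2l.
  have le_surplus := ler_wpM2l (surplus_ge0 OI AI sB) le_dg.
  have def_f : f (u |: A) = f A + d by rewrite -def_d /marginal; ring.
  rewrite def_f (cardsU B) disjoint_setI0 // cards0 subn0 cardsU1 uA !natrD /=.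
  by lra.
- apply: le_trans (ler_sum_pos_marginal f_sub (forfeited_own _ _ _ _ _)
                     (subxx (u |: A))) _.
  rewrite big_setU1 ?notin_forfeited //= pos_marginal_mem ?setU11 // add0r.
  by apply: le_trans le_lost; apply: ler_sum_pos_marginal.
Qed.

Lemma charged_other : 0 <= d -> charged O N A g w ->
  charged O (N :\ u) A d (w + d).
Proof.
move=> d_ge0 [B [sB le_own le_lost]]; exists B; split=> //.
  by apply: le_trans le_own; rewrite lerD2l ler_wpM2l // (surplus_ge0 OI AI sB).
have [u_avail|u_unavail] := boolP (u \in available I N A); last first.
  have same_avail : available I (N :\ u) A = available I N A.
    apply/setP => v; move: u_unavail; rewrite !availableE !inE.
    by case: eqP => // -> /negPf ->; rewrite andbF.
  by rewrite /forfeited same_avail ler_wpDr.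
apply: le_trans (ler_sum_pos_marginal f_sub (forfeited_other _ _ _ _ _)
                   (subxx A)) _.
by rewrite big_setU1 ?notin_forfeited //= addrC lerD // le_d.
Qed.

End Step.

Lemma charged_exhausted O N A g w : O \in I -> A \in I -> 0 <= g ->
  {in available I N A, forall v, marginal f v A <= 0} ->
  charged O N A g w -> f (O :|: A) <= f A + k * (f A - f set0) + w.
Proof.
move=> OI AI g_ge0 exh [B [sB le_own le_lost]].
apply: le_trans (setU_le_sum_pos_marginal f_sub O A) _.
have sBO : B \subset O by apply: subset_trans sB (subsetIl _ _).
have le_cover : \sum_(v in O :\: B) pos_marginal f v A <= w.
  apply: le_trans le_lost; rewrite (big_setID (available I N A)) /= setDDl.
  by rewrite big1 ?add0r // => v /setIP[_ /exh /max_idPl].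
rewrite (big_setID B) /= (setIidPr sBO).
by have := mulr_ge0 (surplus_ge0 OI AI sB) g_ge0; lra.
Qed.

Section Runs.
Variable l : nat.
Implicit Types (S : 'I_l -> {set T}) (i j : 'I_l).

Definition others_gain S j : R := \sum_(i | i != j) (f (S i) - f set0).

Lemma others_gain_add_same S u j :
  others_gain (add_to S u j) j = others_gain S j.
Proof. by apply: eq_bigr => i ij; rewrite add_to_other. Qed.

Lemma others_gain_add_other S u i j : i != j ->
  others_gain (add_to S u i) j = others_gain S j + marginal f u (S i).
Proof.
move=> ij; rewrite /others_gain (bigD1 i) //= [in RHS](bigD1 i) //=.
rewrite add_to_same /marginal.
under eq_bigr => h /andP[_ hi] do rewrite add_to_other //.
by ring.
Qed.

Lemma others_gain_le S j M : nonnegative f -> (forall i, f (S i) <= M) ->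
  others_gain S j <= (l%:R - 1) * M.
Proof.
move=> f_ge0 le_M; have -> : (l%:R - 1) * M = \sum_(i | i != j) M.
  rewrite sumr_const cardC1 card_ord -[RHS]mulr_natl -subn1 natrB //.
  exact: leq_ltn_trans (ltn_ord j).
by apply: ler_sum => i _; have := f_ge0 set0; have := le_M i; lra.
Qed.

Lemma greedy_run_charged O N S : (forall u, [set u] \in I) -> O \in I ->
  greedy_run f I N S -> exists g, [/\ 0 <= g,
    forall i, {in available I N (S i), forall v, pos_marginal f v (S i) <= g}
    & forall j, charged O N (S j) g (others_gain S j)].
Proof.
move=> I1 OI; elim=> [|{}N {}S u j run [g [g_ge0 le_g chg]] choice].
  exists (\big[Num.max/0]_v pos_marginal f v set0).
  split=> [|i v _|j]; first exact: bigmax_ge_id.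
    exact: (le_bigmax _ (fun v => pos_marginal f v set0)).
  rewrite /others_gain big1 => [|i _]; last exact: subrr.
  exact: charged_start.
have SI i : S i \in I := greedy_run_indep i (indep0 indI) run.
have [u_avail d_gt0 _] := choice.
have le_dg : marginal f u (S j) <= g.
  exact: le_trans (marginal_le_pos f u (S j)) (le_g j u u_avail).
exists (marginal f u (S j)); split=> [|i v|i]; first exact: ltW.
  move/(subsetP (availableS indI (subsetDl _ _) (subset_add_to S u i j))).
  move=> v_avail.
  apply: le_trans (greedy_choice_pos_marginal choice v_avail).
  exact: pos_marginal_antitone (subset_add_to _ _ _ _).
have le_d v : v \in available I N (S i) ->
  pos_marginal f v (S i) <= marginal f u (S j).
  exact: greedy_choice_pos_marginal choice.
have [ij|ij] := eqVneq i j.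
  rewrite {i}ij in le_d *; rewrite add_to_same others_gain_add_same.
  apply: charged_own (chg j) => //.
  exact: greedy_run_fresh run (greedy_choice_mem choice).
rewrite add_to_other // others_gain_add_other 1?eq_sym //.
exact: charged_other le_dg le_d (ltW d_gt0) (chg i).
Qed.

Lemma greedy_run_union_le O N S j M :
  (forall u, [set u] \in I) -> O \in I -> 0 <= k -> nonnegative f ->
  greedy_run f I N S -> exhausted f I N S -> (forall i, f (S i) <= M) ->
  f (O :|: S j) <= (k + l%:R) * M.
Proof.
move=> I1 OI k_ge0 f_ge0 run exh le_M.
have SI : S j \in I := greedy_run_indep j (indep0 indI) run.
have [g [g_ge0 _ chg]] := greedy_run_charged I1 OI run.
apply: le_trans (charged_exhausted OI SI g_ge0 _ (chg j)) _.
  by move=> v; apply: exh.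
have le_own : k * (f (S j) - f set0) <= k * M.
  by apply: ler_wpM2l => //; have := f_ge0 set0; have := le_M j; lra.
by have := others_gain_le j f_ge0 le_M; have := le_M j; lra.
Qed.

End Runs.
End Charging.

Section OracleComputations.
Context {T : finType} {R : Type} {f : {set T} -> R} {I : {set {set T}}}.

(* Implicit arguments are maximal here: used as views, these lemmas would
   otherwise take the subject of the view for x. *)
Lemma exec_ret_inv {X} {x y : X} {c} : exec f I (Ret y) x c -> x = y /\ c = 0%N.
Proof. by move=> run; inversion run. Qed.

Lemma exec_value_inv {X S} {q : R -> oprog T R X} {x c} :
  exec f I (AskValue S q) x c ->
  exists2 c', c = c'.+1 & exec f I (q (f S)) x c'.
Proof. by move=> run; inversion run; eexists; eauto. Qed.

Lemma exec_indep_inv {X S} {q : bool -> oprog T R X} {x c} :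
  exec f I (AskIndep S q) x c ->
  exists2 c', c = c'.+1 & exec f I (q (S \in I)) x c'.
Proof. by move=> run; inversion run; eexists; eauto. Qed.

Lemma exec_choose_inv {X} {p q : oprog T R X} {x c} :
  exec f I (Choose p q) x c -> exec f I p x c \/ exec f I q x c.
Proof. by move=> run; inversion run; [left | right]. Qed.

Lemma exec_bind_inv {X Y} {p : oprog T R X} {q : X -> oprog T R Y} {y c} :
  exec f I (bind p q) y c ->
  exists x c1 c2, [/\ exec f I p x c1, exec f I (q x) y c2 & c = (c1 + c2)%N].
Proof.
elim: p c => [x|S p IH|S p IH|p IHp p' IHp'] c /=.
- by move=> run; exists x, 0%N, c; split=> //; apply: exec_ret.
- case/exec_value_inv => c' -> /IH[x [c1 [c2 [run_p run_q ->]]]].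
  by exists x, c1.+1, c2; split=> //; apply: exec_value.
- case/exec_indep_inv => c' -> /IH[x [c1 [c2 [run_p run_q ->]]]].
  by exists x, c1.+1, c2; split=> //; apply: exec_indep.
- case/exec_choose_inv => [/IHp|/IHp'] [x [c1 [c2 [run_p run_q ->]]]].
    by exists x, c1, c2; split=> //; apply: exec_left.
  by exists x, c1, c2; split=> //; apply: exec_right.
Qed.

End OracleComputations.

Section Maximizers.
Variables (R : realType) (X : eqType).
Implicit Types (s : seq (X * R)) (x : X).

Lemma maximizersP s x :
  reflect (exists2 v, (x, v) \in s & {in s, forall p, p.2 <= v})
          (x \in maximizers s).
Proof.
apply: (iffP mapP) => [[[y v]]|[v xs max_v]].
  by rewrite mem_filter => /andP[/allP max_v ys] /= ->; exists v.
by exists (x, v) => //; rewrite mem_filter xs andbT; apply/allP.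
Qed.

Lemma maximizers_eq_nil s : maximizers s = [::] -> s = [::].
Proof.
case: s => // p s; set ps := p :: s => no_max.
pose gain (i : 'I_(size ps)) := (nth p ps i).2.
have [i _ max_i] := @arg_maxP _ _ _ ord0 xpredT gain isT.
suff: (nth p ps i).1 \in maximizers ps by rewrite no_max.
apply/maximizersP; exists (gain i) => [|q /(nthP p)[j lt_j <-]].
  by rewrite -surjective_pairing mem_nth.
exact: (max_i (Ordinal lt_j)).
Qed.

End Maximizers.

Section AlgorithmRuns.
Variables (R : realType) (T : finType) (f : {set T} -> R) (I : {set {set T}}).
Variable l : nat.
Implicit Types (N : {set T}) (S : 'I_l -> {set T}) (s : seq (T * 'I_l)).

Lemma exec_pick_any {X : eqType} {y : X} {r : seq X} {x c} :
  exec f I (pick_any T R y r) x c -> x \in y :: r /\ c = 0%N.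
Proof.
elim: r y => [|z r IH] y /=.
  by case/exec_ret_inv => -> ->; rewrite mem_head.
case/exec_choose_inv => [/exec_ret_inv[-> ->]|/IH[xs ->]].
  by rewrite mem_head.
by rewrite in_cons xs orbT.
Qed.

Definition admissible_gains S s : seq (T * 'I_l * R) :=
  [seq (p, marginal f p.1 (S p.2)) | p <- s &
    (p.1 |: S p.2 \in I) && (0 < marginal f p.1 (S p.2))].

Lemma exec_admissible S s A c : exec f I (admissible R S s) A c ->
  A = admissible_gains S s /\ (c <= 3 * size s)%N.
Proof.
elim: s A c => [|[u j] s IH] A c /=; first by case/exec_ret_inv => -> ->.
case/exec_indep_inv => c1 ->; rewrite /admissible_gains /=.
case: (u |: S j \in I) => /= [|/IH[-> le_c1]]; last by split=> //; lia.
case/exec_value_inv => c2 -> /exec_value_inv[c3 -> /exec_bind_inv].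
move=> [B [d1 [d2 [/IH[-> le_d1] /exec_ret_inv[-> ->] ->]]]].
by split; [case: ifP | lia].
Qed.

Lemma exec_ask_values S (s : seq 'I_l) V c : exec f I (ask_values R S s) V c ->
  V = [seq (j, f (S j)) | j <- s] /\ c = size s.
Proof.
elim: s V c => [|j s IH] V c /=; first by case/exec_ret_inv => -> ->.
case/exec_value_inv => c1 -> /exec_bind_inv.
move=> [B [d1 [d2 [/IH[-> ->] /exec_ret_inv[-> ->] ->]]]].
by rewrite addn0.
Qed.

Definition candidates N : seq (T * 'I_l) :=
  [seq (u, j) | u <- enum N, j <- enum 'I_l].

Lemma mem_admissible_gains N S u j g :
  ((u, j), g) \in admissible_gains S (candidates N) =
  [&& u \in available I N (S j), 0 < marginal f u (S j) &
      g == marginal f u (S j)].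
Proof.
rewrite availableE.
apply/mapP/and3P => [[[v i]]|[/andP[uI uN] gain_gt0 /eqP->]].
  rewrite mem_filter /= => /andP[/andP[vI gain_gt0]].
  case/allpairsP => -[w h] /= [wN _].
  move=> vi [ui ji ->]; move: vi wN; rewrite ui ji => -[<- _].
  by rewrite mem_enum => ->; rewrite vI.
exists (u, j) => //; rewrite mem_filter /= uI gain_gt0 /=.
by apply/allpairsP; exists (u, j); rewrite !mem_enum.
Qed.

Lemma maximizers_nil_exhausted N S :
  maximizers (admissible_gains S (candidates N)) = [::] -> exhausted f I N S.
Proof.
move=> /maximizers_eq_nil no_gain v i v_avail.
rewrite leNgt; apply/negP => gain_gt0.
have := mem_admissible_gains N S v i (marginal f v (S i)).
by rewrite no_gain v_avail gain_gt0 eqxx.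
Qed.

Lemma mem_maximizers_greedy_choice N S u j :
  (u, j) \in maximizers (admissible_gains S (candidates N)) ->
  greedy_choice f I N S u j.
Proof.
case/maximizersP => g; rewrite mem_admissible_gains.
case/and3P => u_avail gain_gt0 /eqP-> max_g; split=> // v i v_avail.
have [gain_v|] := ltP 0 (marginal f v (S i)); last first.
  by move/le_trans; apply; apply: ltW.
apply: (max_g ((v, i), _)).
by rewrite mem_admissible_gains v_avail gain_v eqxx.
Qed.

Definition round_calls : nat := 3 * (#|T| * l).

Lemma exec_admissible_candidates N S A c :
  exec f I (admissible R S (candidates N)) A c ->
  A = admissible_gains S (candidates N) /\ (c <= round_calls)%N.
Proof.
case/exec_admissible => -> le_c; split=> //; apply: leq_trans le_c _.
by rewrite size_allpairs -cardE size_enum_ord !leq_mul ?max_card.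
Qed.

Lemma exec_greedy_loop m N S S' c : greedy_run f I N S -> (#|N| <= m)%N ->
  exec f I (greedy_loop R m N S) S' c ->
  exists N', [/\ greedy_run f I N' S', exhausted f I N' S' &
    (c + #|N'| * round_calls <= #|N|.+1 * round_calls)%N].
Proof.
elim: m N S c => [|m IH] N S c run le_m.
  case/exec_ret_inv => -> ->; exists N; split=> //; last by rewrite leq_mul.
  move: le_m; rewrite leqn0 cards_eq0 => /eqP-> v i.
  by rewrite availableE inE andbF.
case/exec_bind_inv => _ [c1 [c2 [/exec_admissible_candidates[-> le_c1]]]].
move=> run2 ->.
case def_max: (maximizers _) run2 => [|y s].
  case/exec_ret_inv => -> ->; exists N; split=> //.
    exact: maximizers_nil_exhausted def_max.
  by rewrite addn0 mulSn leq_add2r.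
case/exec_bind_inv => -[u j] [c3 [c4 [/exec_pick_any[uj_max ->] run4 ->]]].
have choice : greedy_choice f I N S u j.
  by apply: mem_maximizers_greedy_choice; rewrite def_max.
have card_N : #|N| = #|N :\ u|.+1.
  by rewrite (cardsD1 u N) (greedy_choice_mem choice).
have le_m' : (#|N :\ u| <= m)%N by rewrite -ltnS -card_N.
have [N' [run' exh le_c]] := IH _ _ _ (greedy_run_step run choice) le_m' run4.
by exists N'; split=> //; rewrite card_N; move: le_c le_c1; rewrite !mulSn; lia.
Qed.

Lemma exec_simultaneous_greedys X c : (0 < l)%N ->
  exec f I (simultaneous_greedys T R l) X c ->
  exists N S, [/\ greedy_run f I N S, exhausted f I N S, X \in codom S,
    forall j, f (S j) <= f X &
    (c <= (\sum_j #|S j|).+1 * round_calls + l)%N].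
Proof.
move=> l_gt0 /exec_bind_inv[S [c1 [c2 [run1 run2 ->]]]].
have le_T : (#|[set: T]| <= #|T|)%N by rewrite cardsT.
have [N [run exh le_c1]] := exec_greedy_loop (greedy_run_start f I l) le_T run1.
case/exec_bind_inv: run2 => _ [c3 [c4 [/exec_ask_values[-> ->] run4 ->]]].
case def_max: (maximizers _) run4 => [|y s].
  move/maximizers_eq_nil/(congr1 size): def_max.
  by rewrite size_map size_enum_ord /=; case: l l_gt0.
case/exec_bind_inv => j [c5 [c6 [/exec_pick_any[j_max ->]]]].
case/exec_ret_inv => -> -> ->; move: j_max; rewrite -def_max.
case/maximizersP => _ /mapP[_ _ [<- ->]] max_j.
exists N, S; split=> // [|i|]; first exact: codom_f.
  by apply: (max_j (i, f (S i))); apply: map_f; rewrite mem_enum.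
rewrite size_enum_ord !addn0 leq_add2r.
by move: le_c1; rewrite cardsT -(greedy_run_card run) -addSn mulnDl leq_add2r.
Qed.

End AlgorithmRuns.

Section Guarantees.
Variables (R : realType) (T : finType) (f : {set T} -> R) (I : {set {set T}}).
Variable l : nat.
Hypotheses (I1 : forall u, [set u] \in I) (l_gt0 : (0 < l)%N).

Lemma simultaneous_greedys_indep X c : independence_system I ->
  exec f I (simultaneous_greedys T R l) X c -> X \in I.
Proof.
move=> indI /(exec_simultaneous_greedys l_gt0)[N [S [run _ /codomP[j ->] _ _]]].
exact: greedy_run_indep (indep0 indI) run.
Qed.

Lemma simultaneous_greedys_calls X c : independence_system I -> (0 < #|T|)%N ->
  exec f I (simultaneous_greedys T R l) X c ->
  (c <= 7 * (l ^ 2 * rank I * #|T|))%N.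
Proof.
move=> indI T_gt0 /(exec_simultaneous_greedys l_gt0)[N [S [run _ _ _ le_c]]].
have rank_gt0 : (0 < rank I)%N.
  case/card_gt0P: T_gt0 => u _.
  by have := indep_card_le_rank (I1 u); rewrite cards1.
have le_size : (\sum_j #|S j| <= l * rank I)%N.
  rewrite -[X in (X * _)%N]card_ord -sum_nat_const leq_sum // => j _.
  by rewrite indep_card_le_rank // (greedy_run_indep j (indep0 indI) run).
have le_rounds : ((\sum_j #|S j|).+1 <= 2 * (l * rank I))%N.
  by have : (0 < l * rank I)%N; [rewrite muln_gt0 l_gt0 | lia].
have le_output : (l <= l * (l * rank I * #|T|))%N.
  by rewrite leq_pmulr // !muln_gt0 l_gt0 rank_gt0.
apply: leq_trans le_c _.
have := leq_mul le_rounds (leqnn (round_calls T l)).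
by rewrite /round_calls; nia.
Qed.

Lemma simultaneous_greedys_calls_le (k a : R) X c : independence_system I ->
  l%:R ^+ 2 <= a * k -> (0 < #|T|)%N ->
  exec f I (simultaneous_greedys T R l) X c ->
  c%:R <= 7 * a * (k * (rank I)%:R * #|T|%:R).
Proof.
move=> indI le_sqr T_gt0 /(simultaneous_greedys_calls indI T_gt0).
rewrite -(ler_nat R) 3!natrM natrX => /le_trans; apply.
by rewrite -!mulrA ler_wpM2l // !mulrA !ler_wpM2r.
Qed.

Variable k : R.
Hypotheses (k_ge0 : 0 <= k) (kI : k_system k I).
Hypotheses (f_ge0 : nonnegative f) (f_sub : submodular f).

Lemma simultaneous_greedys_ratio O X c : O \in I ->
  exec f I (simultaneous_greedys T R l) X c ->
  (l%:R - 1) * f O <= l%:R * (k + l%:R) * f X.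
Proof.
move=> OI /(exec_simultaneous_greedys l_gt0)[N [S [run exh _ best _]]].
have disjS i j : i != j -> [disjoint S i & S j].
  exact: greedy_run_disjoint run.
have := sum_disjoint_union_ge f_sub O f_ge0 (enum_uniq 'I_l) disjS.
rewrite size_enum_ord big_enum => /le_trans; apply.
rewrite -mulrA mulr_natl -[X in _ *+ X]card_ord -sumr_const ler_sum // => j _.
exact: greedy_run_union_le run exh best.
Qed.

Lemma simultaneous_greedys_monotone_ratio O X c : monotone f -> O \in I ->
  exec f I (simultaneous_greedys T R l) X c -> f O <= (k + l%:R) * f X.
Proof.
move=> f_mono OI /(exec_simultaneous_greedys l_gt0)[N [S [run exh _ best _]]].
apply: le_trans (f_mono _ _ (subsetUl O (S (Ordinal l_gt0)))) _.
exact: greedy_run_union_le run exh best.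
Qed.

End Guarantees.

Section NumberOfSolutions.
Variables (R : realType) (k : R).
Local Notation s := (Num.sqrt (k + 2)).

Definition num_solutions : nat := Num.truncn (2 + s).

Lemma num_solutions_bounds : 1 + s < num_solutions%:R <= 2 + s.
Proof.
have s_ge0 : 0 <= s := sqrtr_ge0 _.
have /truncn_itv : 0 <= 2 + s by lra.
by rewrite -/num_solutions -natr1 => /andP[-> lt_succ]; rewrite andbT; lra.
Qed.

Lemma num_solutions_gt0 : (0 < num_solutions)%N.
Proof.
have /andP[lo _] := num_solutions_bounds.
by rewrite -(ltr_nat R); have := sqrtr_ge0 (k + 2); lra.
Qed.

Let sqr_s : -2 <= k -> s ^+ 2 = k + 2.
Proof. by move=> k_ge; rewrite sqr_sqrtr //; lra. Qed.

Lemma num_solutions_ratio_le : -2 <= k ->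
  num_solutions%:R * (k + num_solutions%:R)
    <= (1 + s) ^+ 2 * (num_solutions%:R - 1).
Proof.
move=> /sqr_s s_sqr; have /andP[lo hi] := num_solutions_bounds.
move: (num_solutions%:R : R) lo hi => z lo hi.
have s_ge0 : 0 <= s := sqrtr_ge0 _.
have def_k : k = s ^+ 2 - 2 by rewrite s_sqr; ring.
have slack_ge0 : 0 <= (z - 1 - s) * (2 + s - z) + (1 + s).
  by rewrite addr_ge0 ?mulr_ge0 //; lra.
by rewrite {1}def_k; lra.
Qed.

Lemma num_solutions_sqr_le : 1 <= k -> num_solutions%:R ^+ 2 <= 14 * k.
Proof.
move=> k_ge1; have s_sqr : s ^+ 2 = k + 2 by apply: sqr_s; lra.
have /andP[_ hi] := num_solutions_bounds.
have le_sqr : num_solutions%:R ^+ 2 <= (2 + s) ^+ 2.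
  by rewrite lerXn2r ?nnegrE ?addr_ge0 ?sqrtr_ge0.
by have := sqr_ge0 (s - 2); lra.
Qed.

Lemma ratio_dist_le : 1 <= k -> `|(1 + s) ^+ 2 - k| <= 7 * Num.sqrt k.
Proof.
move=> k_ge1; have s_sqr : s ^+ 2 = k + 2 by apply: sqr_s; lra.
have s_ge0 : 0 <= s := sqrtr_ge0 _.
have sqrtk_ge1 : 1 <= Num.sqrt k by rewrite -[leLHS]sqrtr1 ler_wsqrtr.
have le_s : s <= 2 * Num.sqrt k.
  rewrite -ler_sqr ?nnegrE ?mulr_ge0 ?sqrtr_ge0 //.
  by rewrite exprMn s_sqr sqr_sqrtr; lra.
by rewrite sqrrD s_sqr ger0_norm; lra.
Qed.

End NumberOfSolutions.

Lemma approx_ratio_le_mul (R : realType) (T : finType) (f : {set T} -> R)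
    (I : {set {set T}}) (alpha : R) (S : {set T}) :
  0 < alpha -> (forall O, O \in I -> f O <= alpha * f S) ->
  approx_ratio_le f I alpha S.
Proof.
by move=> alpha_gt0 le_fS O [OI _]; rewrite ler_pdivrMr // mulrC le_fS.
Qed.

Lemma approx_ratio_num_solutions (R : realType) (T : finType)
    (f : {set T} -> R) (I : {set {set T}}) (k : R) (S : {set T})
    (z : R := (num_solutions k)%:R) :
  -2 <= k -> 0 <= f S ->
  (forall O, O \in I -> (z - 1) * f O <= z * (k + z) * f S) ->
  approx_ratio_le f I ((1 + Num.sqrt (k + 2)) ^+ 2) S.
Proof.
move=> k_ge fS_ge0 le_fS; have s_ge0 := sqrtr_ge0 (k + 2).
apply: approx_ratio_le_mul => [|O OI]; first by rewrite exprn_gt0 //; lra.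
have z_gt1 : 0 < z - 1.
  by have /andP[] := num_solutions_bounds k; rewrite -/z; lra.
rewrite -(ler_pM2l z_gt1); apply: le_trans (le_fS O OI) _.
by rewrite mulrA ler_wpM2r // [leRHS]mulrC num_solutions_ratio_le.
Qed.

Theorem theorem3 (R : realType) :
  (exists C : R, forall (T : finType) (I : {set {set T}}) (k : R)
      (f : {set T} -> R),
    1 <= k -> k_system k I -> (forall u : T, [set u] \in I) ->
    nonnegative f -> submodular f ->
    (forall (S : {set T}) (c : nat),
      exec f I (simultaneous_greedys T R (Num.truncn (2 + Num.sqrt (k + 2)))) S c ->
      [/\ S \in I,
          approx_ratio_le f I ((1 + Num.sqrt (k + 2)) ^+ 2) S
        & (0 < #|T|)%N -> c%:R <= C * (k * (rank I)%:R * #|T|%:R)]) /\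
    (monotone f -> forall (S : {set T}) (c : nat),
      exec f I (simultaneous_greedys T R 1%N) S c ->
      [/\ S \in I,
          approx_ratio_le f I (k + 1) S
        & (0 < #|T|)%N -> c%:R <= C * (k * (rank I)%:R * #|T|%:R)])) /\
  (exists C : R, forall k : R, 1 <= k ->
    `|(1 + Num.sqrt (k + 2)) ^+ 2 - k| <= C * Num.sqrt k).
Proof.
split; last by exists 7 => k; apply: ratio_dist_le.
exists (7 * 14) => T I k f k_ge1 kI I1 f_ge0 f_sub.
have indI := kI.1; have k_ge0 : 0 <= k := le_trans ler01 k_ge1.
split=> [S c|f_mono S c] run.
- have l_gt0 := num_solutions_gt0 k; split=> [||T_gt0].
  + exact: (simultaneous_greedys_indep l_gt0 indI run).
  + apply: approx_ratio_num_solutions => // [|O OI]; first lra.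
    exact: simultaneous_greedys_ratio run.
  + exact: simultaneous_greedys_calls_le (num_solutions_sqr_le k_ge1) T_gt0 run.
- split=> [||T_gt0].
  + exact: simultaneous_greedys_indep run.
  + apply: approx_ratio_le_mul => [|O OI]; first exact: ltr_wpDl.
    exact: simultaneous_greedys_monotone_ratio run.
  + by apply: simultaneous_greedys_calls_le T_gt0 run => //; lra.
Qed.
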